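(* Let $m,n \geq k \geq 1$ be integers, and let $A, B \in \mathbb{R}^{m \times n}$. Then all matrices in the interval hull $\mathbb{I}(A,B)$ are totally positive of order $k$ if and only if the two matrices $C^+(A,B)$ and $C^-(A,B)$ are totally positive of order $k$.
   Context: A real matrix is totally positive of order $k$ ($TP_k$) if all its minors of order (size) at most $k$ are positive. For $A=(a_{ij}), B=(b_{ij}) \in \mathbb{R}^{m \times n}$, the interval hull is $$\mathbb{I}(A,B) = \{C \in \mathbb{R}^{m \times n} : c_{ij} = t_{ij} a_{ij} + (1-t_{ij}) b_{ij},\ t_{ij} \in [0,1]\},$$ where the $t_{ij}$ may vary independently over the entries $(i,j)$. For a matrix $M$, $|M|$ denotes the entrywise absolute value, $|M|_{ij} := |m_{ij}|$. For $z \in \{\pm 1\}^p$, $D_z$ is the $p \times p$ diagonal matrix with $(i,i)$ entry $z_i$. For $z \in \{\pm 1\}^m$, $z' \in \{\pm 1\}^n$, define $$I_{z,z'}(A,B) := \frac{A+B}{2} - D_z \frac{|A-B|}{2} D_{z'} .$$ With $d^{\langle p \rangle} := (1,-1,\dots,(-1)^{p-1})^T \in \mathbb{R}^p$, define $C^{\pm}(A,B) := I_{d^{\langle m \rangle},\, \pm d^{\langle n \rangle}}(A,B)$. *)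

(* Defs.v *)
From HB Require Import structures.
From mathcomp Require Import all_boot all_order all_algebra.
From mathcomp Require Import reals.

Set Implicit Arguments.
Unset Strict Implicit.
Unset Printing Implicit Defensive.

Import Order.TTheory GRing.Theory Num.Theory.
Local Open Scope ring_scope.

(* A minor of order r is given by strictly increasing selections f of rows
   and g of columns; no such selection exists when r > m or r > n. *)
Definition totally_positive (R : realType) (k m n : nat) (A : 'M[R]_(m, n))
    : Prop :=
  forall (r : nat) (f : 'I_r -> 'I_m) (g : 'I_r -> 'I_n),
    (0 < r <= k)%N ->
    {homo f : i j / (i < j)%N} -> {homo g : i j / (i < j)%N} ->
    0 < \det (mxsub f g A).

Definition interval_hull (R : realType) (m n : nat) (A B C : 'M[R]_(m, n))
    : Prop :=
  exists T : 'M[R]_(m, n),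
    (forall i j, 0 <= T i j <= 1) /\
    (forall i j, C i j = T i j * A i j + (1 - T i j) * B i j).

(* Sign vectors are stored as rows, the form expected by [diag_mx]. *)
Definition I_mx (R : realType) (m n : nat) (z : 'rV[R]_m) (z' : 'rV[R]_n)
    (A B : 'M[R]_(m, n)) : 'M[R]_(m, n) :=
  2^-1 *: (A + B)
  - diag_mx z *m (2^-1 *: map_mx Num.norm (A - B)) *m diag_mx z'.

(* Indices start at 0, so entry i of (1, -1, 1, ...) is (-1) ^+ i. *)
Definition alt_sign (R : realType) (p : nat) : 'rV[R]_p :=
  \row_(i < p) (-1) ^+ i.

Definition C_plus (R : realType) (m n : nat) (A B : 'M[R]_(m, n)) :=
  I_mx (alt_sign R m) (alt_sign R n) A B.

Definition C_minus (R : realType) (m n : nat) (A B : 'M[R]_(m, n)) :=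
  I_mx (alt_sign R m) (- alt_sign R n) A B.

(* Main.v *)
Require Import Defs.
From HB Require Import structures.
From mathcomp Require Import all_boot all_order all_algebra.
From mathcomp Require Import reals.
From mathcomp Require Import zify ring lra.

(** Put the checkerboard order on matrices: [X <= Y] iff
    [(-1)^(i+j) X i j <= (-1)^(i+j) Y i j] for all [i], [j]. The interval hull
    lies between C+ and C- for this order. The derivative of a determinant in
    its entry (i,j) is [(-1)^(i+j)] times a minor of smaller order, so once the
    minors of order < r are positive on the whole interval, each contiguous
    minor of order r is monotone there and is bounded below by its value at C+
    or C- (according to the parity of the offset). Fekete's criterion passes
    from contiguous minors of order r to all minors of order r. *)

Import Order.TTheory GRing.Theory Num.Theory.
Local Open Scope ring_scope.

(** * Pluecker relations between maximal minors *)

Section Pluecker.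
Context {R : comNzRingType}.

(** Putting a second copy of column [j] in front of [W] gives a singular square matrix [Z]; the sum
    is the expansion of its determinant along the new column. *)
Lemma sum_maximal_minors_eq0 {n} (W : 'M[R]_(n.+1, n)) (j : 'I_n) :
  \sum_(i < n.+1) (-1) ^+ i * \det (row' i W) * W i j = 0.
Proof.
pose Z : 'M[R]_n.+1 :=
  \matrix_(i, l) if unlift ord0 l is Some l' then W i l' else W i j.
have Z0 : \det Z = 0.
  rewrite -det_tr; apply: (@determinant_alternate _ _ _ ord0 (lift ord0 j)) => //.
  by move=> i; rewrite !mxE unlift_none liftK.
rewrite -[RHS]Z0 (expand_det_col Z ord0); apply: eq_bigr => i _.
rewrite /cofactor mxE unlift_none addn0 mulrC; congr (_ * (_ * \det _)).
by apply/matrixP => a b; rewrite !mxE liftK.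
Qed.

(* Laplace expansion along row [t], with [N] the remaining rows: the sum does
   not depend on [t]. *)
Lemma det_insert_row {n} (Q : 'M[R]_n.+1) (N : 'M[R]_(n, n.+1)) (t : 'I_n.+1) :
  row' t Q = N ->
  \sum_(j < n.+1) Q t j * ((-1) ^+ j * \det (col' j N)) = (-1) ^+ t * \det Q.
Proof.
move=> QN; rewrite (expand_det_row Q t) mulr_sumr; apply: eq_bigr => j _.
have -> : col' j N = row' t (col' j Q).
  by rewrite -QN; apply/matrixP => a b; rewrite !mxE.
rewrite /cofactor [in RHS]mulrCA; congr (_ * _).
by rewrite mulrA exprD mulrA -expr2 sqrr_sign mul1r.
Qed.

(* Three-term Pluecker relation for the rows 0, s + 1 and n + 2 of W. *)
Lemma det_three_term {n} (W : 'M[R]_(n.+3, n.+2)) (s : 'I_n.+1) :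
  let W' := col' ord_max W in
  \det (row' (lift ord0 (lift ord_max s)) W)
    * \det (rowsub (fun i => lift ord0 (lift ord_max i)) W')
  = \det (row' ord0 W)
      * \det (rowsub (fun i => lift ord_max (lift (lift ord0 s) i)) W')
  + \det (row' ord_max W)
      * \det (rowsub (fun i => lift ord0 (lift (lift ord_max s) i)) W').
Proof.
move=> W'.
(* [u] lists the rows other than the three special ones. [e i] is the determinant of row [i] of [W']
   stacked on [N], so it vanishes on the rows listed by [u]. *)
pose u i : 'I_n.+3 := lift ord0 (lift ord_max (lift s i)).
pose N := rowsub u W'.
pose e i := \sum_(j < n.+1) W' i j * ((-1) ^+ j * \det (col' j N)).
have e_sub (f : 'I_n.+1 -> 'I_n.+3) (t : 'I_n.+1) :
    (forall i, f (lift t i) = u i) ->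
    e (f t) = (-1) ^+ t * \det (rowsub f W').
  move=> fu; rewrite -(@det_insert_row _ _ N).
    by apply: eq_bigr => j _; rewrite [in RHS]mxE.
  by apply/matrixP => a b; rewrite !mxE fu.
have e_u i : e (u i) = 0.
  pose Q : 'M[R]_n.+1 := \matrix_(a, b)
    W' (if unlift ord0 a is Some a' then u a' else u i) b.
  have -> : e (u i) = (-1) ^+ (@ord0 n) * \det Q.
    rewrite -(@det_insert_row _ _ N).
      by apply: eq_bigr => j _; rewrite [in RHS]mxE unlift_none.
    by apply/matrixP => a b; rewrite !mxE liftK.
  rewrite (@determinant_alternate _ _ Q ord0 (lift ord0 i)) ?mulr0 // => j.
  by rewrite !mxE unlift_none liftK.
have e_mid : e (lift ord0 (lift ord_max s)) =
    (-1) ^+ s * \det (rowsub (fun i => lift ord0 (lift ord_max i)) W').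
  exact: (@e_sub (fun i => lift ord0 (lift ord_max i)) s).
have e_0 : e ord0 =
    \det (rowsub (fun i => lift ord_max (lift (lift ord0 s) i)) W').
  rewrite -[RHS]mul1r -(expr0 (-1)).
  rewrite -(@e_sub (fun i => lift ord_max (lift (lift ord0 s) i)) ord0).
    by congr e; apply: val_inj; rewrite /= /bump; lia.
  by move=> i; apply: val_inj; rewrite /= /bump; have := ltn_ord i; lia.
have e_max : e ord_max = (-1) ^+ n *
    \det (rowsub (fun i => lift ord0 (lift (lift ord_max s) i)) W').
  rewrite -(@e_sub (fun i => lift ord0 (lift (lift ord_max s) i)) ord_max).
    by congr e; apply: val_inj; rewrite /= /bump; have := ltn_ord s; lia.
  move=> i; apply: val_inj; rewrite /= /bump.
  by have := ltn_ord i; have := ltn_ord s; lia.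
(* [e i] combines the entries of row [i] with coefficients independent of [i], so the relation
   between the rows of [W] carries over to [e]; only the three special rows survive in it. *)
have De : \sum_(i < n.+3) (-1) ^+ i * \det (row' i W) * e i = 0.
  under eq_bigr do rewrite mulr_sumr.
  rewrite exchange_big big1 // => j _.
  under eq_bigr do rewrite mulrA.
  rewrite -mulr_suml.
  under eq_bigr do rewrite [W' _ _]mxE.
  by rewrite sum_maximal_minors_eq0 mul0r.
have e_lift i : e (lift ord0 (lift ord_max (lift s i))) = 0 by exact: e_u.
move: De; rewrite big_ord_recl big_ord_recr /= (bigD1_ord s) //=.
under eq_bigr => i _.
  have -> : widen_ord (leqnSn n.+1) (lift s i) = lift ord_max (lift s i).
    by apply: ord_inj; rewrite lift_max.
  rewrite e_lift mulr0; over.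
have -> : widen_ord (leqnSn n.+1) s = lift ord_max s.
  by apply: ord_inj; rewrite lift_max.
have -> : lift ord0 (ord_max : 'I_n.+2) = ord_max by apply: val_inj.
rewrite big1 // addr0 e_0 e_mid e_max.
suff alg (D0 m0 Ds ms Dm mm : R) :
    (-1) ^+ 0 * D0 * m0 + ((-1) ^+ s.+1 * Ds * ((-1) ^+ s * ms)
      + (-1) ^+ n.+2 * Dm * ((-1) ^+ n * mm)) = 0 ->
    Ds * ms = D0 * m0 + Dm * mm by exact: alg.
have sgn2 p : (-1) ^+ p * (-1) ^+ p = 1 :> R by rewrite -expr2 sqrr_sign.
rewrite !exprS expr0 !mulN1r opprK => De.
apply/eqP; rewrite eq_sym -subr_eq0 -De; apply/eqP.
have -> : Ds * ms = (-1) ^+ s * (-1) ^+ s * (Ds * ms) by rewrite sgn2 mul1r.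
have -> : Dm * mm = (-1) ^+ n * (-1) ^+ n * (Dm * mm) by rewrite sgn2 mul1r.
ring.
Qed.

End Pluecker.

(** * Fekete's criterion *)

Section Fekete.
Context {R : realDomainType}.

Definition contiguous {r m} (f : 'I_r -> 'I_m) :=
  exists p, forall i, f i = (p + i)%N :> nat.

(** [lift ord_max s] and [lift ord0 s] are the consecutive indices [s] and [s + 1]. If no such step
    skips a value, induction gives [f i = f 0 + i]. *)
Lemma increasing_gap {r m} (f : 'I_r.+1 -> 'I_m) :
  {homo f : i j / (i < j)%N} ->
  contiguous f \/ exists s : 'I_r, ((f (lift ord_max s)).+1 < f (lift ord0 s))%N.
Proof.
move=> fI.
case: (boolP [exists s : 'I_r, (f (lift ord_max s)).+1 < f (lift ord0 s)]%N).
  by move/existsP=> gap; right.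
move=> /existsPn noGap; left; exists (f ord0) => -[i].
elim: i => [|i IH] lt_i; first by rewrite addn0; congr (nat_of_ord (f _)); apply: val_inj.
have lt_i' : (i < r)%N by lia.
have := noGap (Ordinal lt_i').
have -> : lift ord_max (Ordinal lt_i') = Ordinal (ltnW lt_i).
  by apply: ord_inj; rewrite lift_max.
have -> : lift ord0 (Ordinal lt_i') = Ordinal lt_i by apply: val_inj.
have := fI (Ordinal (ltnW lt_i)) (Ordinal lt_i) (ltnSn i).
by rewrite IH /=; lia.
Qed.

(* Induction on the span f(last) - f(0): insert into f a row lying in one of its
   gaps; omitting instead the first or the last row decreases the span, and
   [det_three_term] expresses the minor through those two. *)
Lemma fekete_rows {r m} (M : 'M[R]_(m, r.+2)) :
  (forall f : 'I_r.+1 -> 'I_m, {homo f : i j / (i < j)%N} ->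
     0 < \det (rowsub f (col' ord_max M))) ->
  (forall f : 'I_r.+2 -> 'I_m, contiguous f -> 0 < \det (rowsub f M)) ->
  forall f : 'I_r.+2 -> 'I_m, {homo f : i j / (i < j)%N} ->
    0 < \det (rowsub f M).
Proof.
move=> small cont f fI.
have [d] := ubnP (f ord_max - f ord0)%N; elim: d => // d IH in f fI *.
move=> le_d.
have [/cont //|[s gap]] := increasing_gap _ fI.
have lt_p : ((f (lift ord_max s)).+1 < m)%N.
  by apply: ltn_trans gap _; apply: ltn_ord.
pose s1 : 'I_r.+3 := lift ord0 (lift ord_max s).
have s1E : s1 = s.+1 :> nat by rewrite /s1 /= /bump; have := ltn_ord s; lia.
(* [h] is [f] with the row [f s + 1] inserted at position [s + 1]; the gap keeps it strictly
   increasing. *)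
pose h i := if unlift s1 i is Some j then f j else Ordinal lt_p.
have fW (i j : 'I_r.+2) : (i <= j)%N -> (f i <= f j)%N.
  by rewrite leq_eqVlt => /orP[/eqP/val_inj -> //|/fI/ltnW].
have lift_s1 (i : 'I_r.+2) : lift s1 i = bump s.+1 i :> nat by rewrite -s1E.
have hI : {homo h : i j / (i < j)%N}.
  move=> i j; rewrite /h.
  case: unliftP => [i' ->|->]; case: unliftP => [j' ->|->]; rewrite ?lift_s1 ?s1E.
  - by move=> lt_ij; apply: fI; move: lt_ij; rewrite /bump; lia.
  - move=> lt_i; rewrite ltnS; apply: fW; move: lt_i; rewrite lift_max /bump; lia.
  - move=> lt_j; apply: leq_trans gap _; apply: fW; move: lt_j.
    by rewrite /= /bump; lia.
  - by rewrite ltnn.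
have h_s1 j : h (lift s1 j) = f j by rewrite /h liftK.
have h0 : h ord0 = f ord0.
  by rewrite -h_s1; congr h; apply: ord_inj; rewrite lift_s1.
have hm : h ord_max = f ord_max.
  rewrite -h_s1; congr h; apply: ord_inj; rewrite lift_s1 /= /bump.
  by have := ltn_ord s; lia.
have liftI n (a : 'I_n.+1) : {homo lift a : i j / (i < j)%N}.
  by move=> i j; rewrite /= /bump; lia.
have := det_three_term (rowsub h M) s; cbv zeta.
have sub_row' t : row' t (rowsub h M) = rowsub (h \o lift t) M.
  by apply/matrixP => a b; rewrite !mxE.
have sub_col' (f' : 'I_r.+1 -> 'I_r.+3) :
    rowsub f' (col' ord_max (rowsub h M)) = rowsub (h \o f') (col' ord_max M).
  by apply/matrixP => a b; rewrite !mxE.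
rewrite !sub_row' !sub_col' /=.
have -> : rowsub (h \o lift (lift ord0 (lift ord_max s))) M = rowsub f M.
  by apply/matrixP => a b; rewrite !mxE /= h_s1.
have lt_h01 : (h ord0 < h (lift ord0 ord0))%N by apply: hI.
have lt_hm : (h (lift ord_max ord_max) < h ord_max)%N.
  by apply: hI; rewrite lift_max.
have lt0m : (f ord0 < f ord_max)%N by apply: fI.
have eq_max : lift ord0 (ord_max : 'I_r.+2) = ord_max by apply: val_inj.
have eq_0 : lift ord_max (ord0 : 'I_r.+2) = ord0 by apply: val_inj.
have pos0 : 0 < \det (rowsub (h \o lift ord0) M).
  apply: IH => [i j /liftI-/(_ ord0)/hI //|/=].
  by rewrite eq_max hm; move: le_d lt_h01; rewrite h0; lia.
have posm : 0 < \det (rowsub (h \o lift ord_max) M).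
  apply: IH => [i j /liftI-/(_ ord_max)/hI //|/=].
  by rewrite eq_0 h0; move: le_d lt_hm; rewrite hm; lia.
have sm1 : 0 <
    \det (rowsub (h \o (fun i => lift ord0 (lift ord_max i))) (col' ord_max M)).
  by apply: small => i j lt_ij; apply/hI/liftI/liftI.
have sm2 : 0 <
    \det (rowsub (h \o (fun i => lift ord_max (lift (lift ord0 s) i))) (col' ord_max M)).
  by apply: small => i j lt_ij; apply/hI/liftI/liftI.
have sm3 : 0 <
    \det (rowsub (h \o (fun i => lift ord0 (lift (lift ord_max s) i))) (col' ord_max M)).
  by apply: small => i j lt_ij; apply/hI/liftI/liftI.
by move=> E; rewrite -(pmulr_lgt0 _ sm1) E addr_gt0 ?mulr_gt0.
Qed.

(** [fekete_rows] is used twice: first on rows, with contiguous columns, then on columns by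
    transposition, with arbitrary increasing rows. *)
Lemma fekete {r m n} (M : 'M[R]_(m, n)) :
  (forall (f : 'I_r -> 'I_m) (g : 'I_r -> 'I_n),
     {homo f : i j / (i < j)%N} -> {homo g : i j / (i < j)%N} ->
     0 < \det (mxsub f g M)) ->
  (forall (f : 'I_r.+1 -> 'I_m) (g : 'I_r.+1 -> 'I_n),
     contiguous f -> contiguous g -> 0 < \det (mxsub f g M)) ->
  forall (f : 'I_r.+1 -> 'I_m) (g : 'I_r.+1 -> 'I_n),
     {homo f : i j / (i < j)%N} -> {homo g : i j / (i < j)%N} ->
     0 < \det (mxsub f g M).
Proof.
case: r => [|r] small cont f g fI gI.
  by apply: cont; [exists (f ord0)|exists (g ord0)] => i; rewrite ord1 addn0.
have contI p q (a : 'I_p -> 'I_q) : contiguous a -> {homo a : i j / (i < j)%N}.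
  by move=> [c ac] i j; rewrite !ac ltn_add2l.
have lI : {homo lift (ord_max : 'I_r.+2) : i j / (i < j)%N}.
  by move=> i j; rewrite !lift_max.
have colC (f' : 'I_r.+2 -> 'I_m) (g' : 'I_r.+2 -> 'I_n) :
    {homo f' : i j / (i < j)%N} -> contiguous g' ->
    0 < \det (mxsub f' g' M).
  move=> f'I g'C.
  have -> : mxsub f' g' M = rowsub f' (colsub g' M) by apply/matrixP => a b; rewrite !mxE.
  apply: fekete_rows f'I => [f1 f1I|f1 f1C].
    have -> : rowsub f1 (col' ord_max (colsub g' M)) = mxsub f1 (g' \o lift ord_max) M.
      by apply/matrixP => a b; rewrite !mxE.
    by apply: small => // i j /lI; apply: contI.
  have -> : rowsub f1 (colsub g' M) = mxsub f1 g' M by apply/matrixP => a b; rewrite !mxE.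
  exact: cont.
have tr_sub p (f1 : 'I_p -> 'I_m) (g1 : 'I_p -> 'I_n) :
    \det (mxsub f1 g1 M) = \det (mxsub g1 f1 M^T).
  by rewrite -det_tr; congr (\det _); apply/matrixP => a b; rewrite !mxE.
have -> : \det (mxsub f g M) = \det (rowsub g (rowsub f M)^T).
  by rewrite tr_sub; congr (\det _); apply/matrixP => a b; rewrite !mxE.
apply: fekete_rows gI => [g1 g1I|g1 g1C].
  have -> : rowsub g1 (col' ord_max (rowsub f M)^T) = mxsub g1 (f \o lift ord_max) M^T.
    by apply/matrixP => a b; rewrite !mxE.
  by rewrite -tr_sub; apply: small => // i j /lI; apply: fI.
have -> : rowsub g1 (rowsub f M)^T = mxsub g1 f M^T by apply/matrixP => a b; rewrite !mxE.
by rewrite -tr_sub; apply: colC.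
Qed.

(** * Monotonicity of minors in the checkerboard order *)

Definition checkerboard_le {m n} (X Y : 'M[R]_(m, n)) :=
  forall (i : 'I_m) (j : 'I_n), (-1) ^+ (i + j) * X i j <= (-1) ^+ (i + j) * Y i j.

(** The rows of [X] are replaced by those of [P] one at a time. Expanding along the replaced row,
    the cofactors do not change, and their signs are those of the checkerboard order. *)
Lemma det_checkerboard_le {n} (P X : 'M[R]_n.+1) :
  checkerboard_le P X ->
  (forall t (i j : 'I_n.+1),
     0 <= \det (row' i (col' j
            (\matrix_(a, b) if (a < t)%N then P a b else X a b)))) ->
  \det P <= \det X.
Proof.
move=> le_PX minor_ge0.
pose Y t : 'M[R]_n.+1 := \matrix_(a, b) if (a < t)%N then P a b else X a b.
have Y0 : Y 0%N = X by apply/matrixP => a b; rewrite !mxE.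
have YP : Y n.+1 = P by apply/matrixP => a b; rewrite !mxE ltn_ord.
suff mono t : (t <= n.+1)%N -> \det (Y t) <= \det (Y 0%N).
  by have := mono n.+1 (leqnn _); rewrite Y0 YP.
elim: t => // t IH lt_t; apply: le_trans (IH (ltnW lt_t)).
pose i := Ordinal lt_t.
rewrite !(expand_det_row _ i); apply: ler_sum => j _.
have -> : cofactor (Y t.+1) i j = cofactor (Y t) i j.
  rewrite /cofactor; congr (_ * \det _); apply/matrixP => a b; rewrite !mxE.
  by rewrite /= /bump; case: ifP; case: ifP => //; lia.
rewrite [Y _ i j]mxE [Y t i j]mxE /= ltnn ltnSn /cofactor !mulrA.
apply: (ler_wpM2r (minor_ge0 t i j)); rewrite ![_ * (-1) ^+ _]mulrC; apply: le_PX.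
Qed.

(** [C] is quantified after [r] because the induction on [r] also needs the smaller minors of
    matrices mixing rows of [C] with rows of [L] or [U]. *)
Lemma checkerboard_interval_minors_gt0 {k m n} (L U : 'M[R]_(m, n)) :
  (forall r (f : 'I_r -> 'I_m) (g : 'I_r -> 'I_n), (0 < r <= k)%N ->
     {homo f : i j / (i < j)%N} -> {homo g : i j / (i < j)%N} ->
     0 < \det (mxsub f g L) /\ 0 < \det (mxsub f g U)) ->
  forall r, (r <= k)%N -> forall C, checkerboard_le L C -> checkerboard_le C U ->
  forall (f : 'I_r -> 'I_m) (g : 'I_r -> 'I_n),
    {homo f : i j / (i < j)%N} -> {homo g : i j / (i < j)%N} ->
    0 < \det (mxsub f g C).
Proof.
move=> tpLU; elim=> [|r IH] le_r C LC CU; first by move=> f g _ _; rewrite det_mx00.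
apply: fekete => [f g|f g [p fp] [q gq]]; first exact: IH (ltnW le_r) C LC CU f g.
have fI : {homo f : i j / (i < j)%N} by move=> i j; rewrite !fp ltn_add2l.
have gI : {homo g : i j / (i < j)%N} by move=> i j; rewrite !gq ltn_add2l.
have [posL posU] := tpLU r.+1 f g le_r fI gI.
have le_LU : checkerboard_le L U by move=> i j; apply: le_trans (CU i j).
(* Passing to the block with corner ([p], [q]) multiplies the checkerboard signs by (-1)^(p+q), so
   for odd [p + q] the order is reversed and [U] becomes the lower bound. *)
pose E := if odd (p + q) then U else L.
have posE : 0 < \det (mxsub f g E) by rewrite /E; case: ifP.
have [LE EU] : checkerboard_le L E /\ checkerboard_le E U.
  by rewrite /E; case: ifP => _; split=> // i j.
apply: lt_le_trans posE _; apply: det_checkerboard_le => [i j|t i j].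
  rewrite ![mxsub _ _ _ _ _]mxE.
  have sgnE : (-1) ^+ (i + j) = (-1) ^+ odd (p + q) * (-1) ^+ (f i + g j) :> R.
    rewrite signr_odd -exprD fp gq -[LHS]signr_odd -[RHS]signr_odd.
    by congr (_ ^+ nat_of_bool _); lia.
  rewrite sgnE -!mulrA /E; case: ifP => _; last by rewrite !mul1r; apply: LC.
  by rewrite expr1 !mulN1r lerN2; apply: CU.
(* Since [f a = p + a], mixing the first [t] rows of the block comes from mixing whole rows of [E]
   and [C], which stays between [L] and [U]. *)
pose C' : 'M[R]_(m, n) := \matrix_(a, b) if (a < p + t)%N then E a b else C a b.
have -> : row' i (col' j (\matrix_(a, b)
      if (a < t)%N then mxsub f g E a b else mxsub f g C a b))
    = mxsub (f \o lift i) (g \o lift j) C'.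
  by apply/matrixP => a b; rewrite !mxE /= fp ltn_add2l.
apply: ltW; apply: IH (ltnW le_r) _ _ _ _ _ _ _ => [a b|a b|a b lt_ab|a b lt_ab].
- by rewrite mxE; case: ifP => _; [apply: LE|apply: LC].
- by rewrite mxE; case: ifP => _; [apply: EU|apply: CU].
- by apply: fI; rewrite /= /bump; lia.
- by apply: gI; rewrite /= /bump; lia.
Qed.

End Fekete.

(** * The interval hull in the checkerboard order *)

Section Hull.
Context {R : realType} {m n : nat}.
Implicit Types A B C : 'M[R]_(m, n).

Lemma C_plusE A B i j : C_plus A B i j =
  (A i j + B i j) / 2 - (-1) ^+ (i + j) * (`|A i j - B i j| / 2).
Proof.
rewrite /C_plus /I_mx mul_diag_mx mul_mx_diag !mxE exprD; ring.
Qed.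

Lemma C_minusE A B i j : C_minus A B i j =
  (A i j + B i j) / 2 + (-1) ^+ (i + j) * (`|A i j - B i j| / 2).
Proof.
rewrite /C_minus /I_mx mul_diag_mx mul_mx_diag !mxE exprD; ring.
Qed.

(** Midpoint and radius form: the deviation of [C] from the midpoint is [T - 1/2] times [A - B],
    entrywise. *)
Lemma interval_hullP A B C : interval_hull A B C <->
  forall i j, `|C i j - (A i j + B i j) / 2| <= `|A i j - B i j| / 2.
Proof.
split=> [[T [T01 CE]] i j|le_C].
  have -> : C i j - (A i j + B i j) / 2 = (T i j - 1 / 2) * (A i j - B i j).
    by rewrite CE; field.
  rewrite normrM mulrC ler_wpM2l // ler_norml; have := T01 i j; lra.
(* Where [A] and [B] agree any weight in [0, 1] would do, and 0 is taken; elsewhere the weight is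
   solved for. *)
pose T : 'M[R]_(m, n) := \matrix_(i, j)
  if A i j == B i j then 0 else (C i j - B i j) / (A i j - B i j).
exists T; split=> i j; have := le_C i j; rewrite !mxE; case: eqVneq => [->|neq].
- by rewrite lexx ler01.
- have d0 : A i j - B i j != 0 by rewrite subr_eq0.
  have -> : C i j - (A i j + B i j) / 2 =
      ((C i j - B i j) / (A i j - B i j) - 1 / 2) * (A i j - B i j) by field.
  by rewrite normrM mulrC ler_pM2l ?normr_gt0 // ler_norml; lra.
- by rewrite subrr normr0 mul0r normr_le0 => /eqP; lra.
- have d0 : A i j - B i j != 0 by rewrite subr_eq0.
  by move=> _; field.
Qed.

Lemma C_plus_interval_hull A B : interval_hull A B (C_plus A B).
Proof.
apply/interval_hullP => i j; rewrite C_plusE addrC addKr normrN normrM normr_sign mul1r.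
by rewrite ger0_norm ?divr_ge0.
Qed.

Lemma C_minus_interval_hull A B : interval_hull A B (C_minus A B).
Proof.
apply/interval_hullP => i j; rewrite C_minusE addrC addKr normrM normr_sign mul1r.
by rewrite ger0_norm ?divr_ge0.
Qed.

(** After multiplication by (-1)^(i+j), the entries of [C_plus] and [C_minus] are the signed
    midpoint minus and plus the radius. *)
Lemma interval_hull_checkerboard A B C : interval_hull A B C ->
  checkerboard_le (C_plus A B) C /\ checkerboard_le C (C_minus A B).
Proof.
move=> /interval_hullP le_C.
split=> i j; have := le_C i j; rewrite ?C_plusE ?C_minusE ler_norml -signr_odd;
  by case: (odd _); rewrite ?expr1 ?expr0; lra.
Qed.

End Hull.

Theorem theoremB (R : realType) (m n k : nat) (hk : (1 <= k)%N)
    (hm : (k <= m)%N) (hn : (k <= n)%N) (A B : 'M[R]_(m, n)) :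
  (forall C : 'M[R]_(m, n), interval_hull A B C -> totally_positive k C)
  <-> (totally_positive k (C_plus A B) /\ totally_positive k (C_minus A B)).
Proof.
split=> [tp|[tpL tpU] C /interval_hull_checkerboard[LC CU] r f g /andP[r0 rk]].
  by split; apply: tp; [apply: C_plus_interval_hull|apply: C_minus_interval_hull].
apply: checkerboard_interval_minors_gt0 rk C LC CU f g => r' f' g' hr' fI gI.
by split; [apply: tpL|apply: tpU].
Qed.
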